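(* Let $(P,\le,{}',0,1)$ be an orthoposet and $a,b\in P$. Then the following holds: (i) $c(a,b)=c(a,b')=c(a',b)=c(a',b')=c(b,a)=c(b,a')=c(b',a)=c(b',a')$; (ii) $a\mathrel{\mathrm C}b$ if and only if $a\mathrel{\mathrm C}b'$; (iii) $S(a,b)=S(b,a)$ and $F(a,b)=F(b,a)$; (iv) $F(a,b)=\big(S(a',b')\big)'$ and $S(a,b)=\big(F(a',b')\big)'$; (v) $S(0,a)=S(a,0)=S(a,a)=U(a)$ and $S(a,a')=S(a,1)=S(1,a)=1$; (vi) $F(0,a)=F(a,0)=F(a,a')=0$ and $F(a,a)=F(a,1)=F(1,a)=L(a)$; (vii) $U(a,b)\subseteq S(a,b)$ and $L(a,b)\subseteq F(a,b)$; (viii) $c(a,b)=S(a,b)\cap U\big(L(a',b')\big)$ and $\big(c(a,b)\big)'=F(a,b)\cap L\big(U(a',b')\big)$; (ix) if $a\le b$ then $a\mathrel{\mathrm C}b$, $b'\mathrel{\mathrm C}a'$, $c(a,b)=S(a,b)\cap U(b')$ and $\big(c(a,b)\big)'=F(a,b)\cap L(a')$; (x) if $a\perp b$ then $S(a,b)=U(a,b)$, and if $a'\perp b'$ then $F(a,b)=L(a,b)$; (xi) if $a\mathrel{\mathrm C}b$ and $b\mathrel{\mathrm C}a$ then $S(a,b)=U(a,b)$; (xii) if $a'\mathrel{\mathrm C}b'$ and $b'\mathrel{\mathrm C}a'$ then $F(a,b)=L(a,b)$; (xiii) if $a\mathrel{\mathrm C}b$ and $a'\mathrel{\mathrm C}b'$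 then $c(a,b)=1$.
   Context: An orthoposet is a bounded poset $(P,\le,{}',0,1)$ with an antitone involution ${}'$ (i.e. $x\le y$ implies $y'\le x'$, and $x''=x$) that is a complementation (i.e. $x\vee x'=1$ and $x\wedge x'=0$ for all $x$). For $a,b\in P$, $a\perp b$ means $a\le b'$. For $A\subseteq P$: $L(A):=\{x\in P\mid x\le y\text{ for all }y\in A\}$, $U(A):=\{x\in P\mid y\le x\text{ for all }y\in A\}$, $A':=\{x'\mid x\in A\}$. When several arguments (elements and/or subsets) are listed inside $L$ or $U$, the operator is applied to the union of these sets, elements being read as singletons; e.g. $L(a,b)=L(\{a,b\})$, $U(A,B)=U(A\cup B)$. Singletons are identified with their unique element (so e.g. $c(a,b)=1$ means $c(a,b)=\{1\}$). For $x,y\in P$ define $S(x,y):=U\big(L(x,y),L(x,y'),L(x',y)\big)$, $F(x,y):=L\big(U(x,y),U(x,y'),U(x',y)\big)$, $c(x,y):=U\big(L(x,y),L(x,y'),L(x',y),L(x',y')\big)$, and $x\mathrel{\mathrm C}y$ if $U(x)=U\big(L(x,y),L(x,y')\big)$. *)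

(* Defs.v *)
From HB Require Import structures.
From mathcomp Require Import all_boot all_order classical_sets.

Set Implicit Arguments.
Unset Strict Implicit.
Unset Printing Implicit Defensive.

Local Open Scope order_scope.
Local Open Scope classical_set_scope.

(* Joins and meets need not exist in P, so "x \/ x' = 1" says that the join
   of x and x' exists and is the top element, and dually for the meet.
   The degenerate case 0 = 1 is allowed. *)
HB.mixin Record hasOrthocomplement d T of Order.TBPOrder d T := {
  ortho : T -> T;
  ortho_anti : forall x y : T, x <= y -> ortho y <= ortho x;
  orthoK : forall x : T, ortho (ortho x) = x;
  ortho_join : forall x : T, supremums [set x; ortho x] \top;
  ortho_meet : forall x : T, infimums [set x; ortho x] \bot }.

#[short(type="orthoposetType")]
HB.structure Definition Orthoposet d :=
  { T of hasOrthocomplement d T & Order.TBPOrder d T }.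

Section OrthoposetOperations.
Context {d : Order.disp_t} {P : orthoposetType d}.
Implicit Types (x y : P) (A : set P).

(* The cones U(A) and L(A) are the library's ubound A and lbound A. *)
Definition U2 x y : set P := ubound [set x; y].
Definition L2 x y : set P := lbound [set x; y].

Definition oset A : set P := [set ortho x | x in A].

Definition perp x y : Prop := x <= ortho y.

Definition Sop x y : set P :=
  ubound (L2 x y `|` L2 x (ortho y) `|` L2 (ortho x) y).

Definition Fop x y : set P :=
  lbound (U2 x y `|` U2 x (ortho y) `|` U2 (ortho x) y).

Definition cop x y : set P :=
  ubound (L2 x y `|` L2 x (ortho y) `|` L2 (ortho x) y
          `|` L2 (ortho x) (ortho y)).

Definition Crel x y : Prop :=
  ubound [set x] = ubound (L2 x y `|` L2 x (ortho y)).

End OrthoposetOperations.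

(* Main.v *)
Require Import Defs.
From HB Require Import structures.
From mathcomp Require Import all_boot all_order classical_sets.

(** Two observations reduce the proposition to set algebra.

    First, [ubound] turns unions into intersections, so each of the sets
    [Sop a b] and [cop a b] is an intersection of blocks
    [U(L(x, y)) = ubound (L2 x y)] with [x] in [{a, a'}] and [y] in [{b, b'}]
    ([SopE], [copE]), and [a C b] says that [U(a)] is the intersection of the
    two blocks with [x = a] ([CrelE]).  These blocks are symmetric in [x] and
    [y], and can be computed in two cases: [U(L(x, y)) = U(x)] when [x <= y]
    ([ubound_L2_le]), and [U(L(x, y)) = P] when [x] is below [y']
    ([ubound_L2_perp]), since [x] and [y] then have [0] as their only common
    lower bound.  Together with [U(x) `&` U(x') = {1}], from [x \/ x' = 1],
    this gives all the assertions about [S], [c] and [C].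

    Second, the antitone involution exchanges upper and lower cones, so that
    [F(a, b)] is the image of [S(a', b')] ([oset_Sop]).  Every assertion about
    [F] is therefore the image of the corresponding one about [S]. *)

Local Open Scope order_scope.
Local Open Scope classical_set_scope.

Import Order.TTheory.

Section Orthoposet.
Context {d : Order.disp_t} {P : orthoposetType d}.
Implicit Types (x y z : P) (A B : set P).

(** * Upper cones and blocks *)

Lemma ubound_setU A B : ubound (A `|` B) = ubound A `&` ubound B.
Proof.
apply/seteqP; split=> [z hz|z [hA hB] y [/hA|/hB] //].
by split=> y hy; apply: hz; [left | right].
Qed.

Lemma U2E x y : U2 x y = ubound [set x] `&` ubound [set y].
Proof. exact: ubound_setU. Qed.

Lemma in_L2 x y z : L2 x y z <-> z <= x /\ z <= y.
Proof.
split=> [hz|[hx hy] t [->|->] //].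
by split; apply: hz; [left | right].
Qed.

Lemma L2C x y : L2 x y = L2 y x.
Proof. by rewrite /L2 setUC. Qed.

Lemma ubound_bot : ubound [set \bot : P] = setT.
Proof. by apply/seteqP; split=> // z _ t ->; exact: le0x. Qed.

Lemma ubound1_ortho x : ubound [set x] `&` ubound [set ortho x] = [set \top].
Proof.
rewrite -ubound_setU; apply/seteqP; split=> [z hz|z -> t _]; last exact: lex1.
have [_ top_least] := ortho_join x.
by apply: le_anti; rewrite lex1 top_least.
Qed.

Lemma ubound_L2_le x y : x <= y -> ubound (L2 x y) = ubound [set x].
Proof.
move=> xy; apply/seteqP; split=> z hz.
  by move=> t ->; apply: hz; apply/in_L2.
by move=> t /in_L2[tx _]; apply: le_trans tx _; apply: hz.
Qed.

Lemma ubound_L2_sub x y : ubound [set x] `<=` ubound (L2 x y).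
Proof. by move=> z hz t /in_L2[tx _]; apply: le_trans tx _; apply: hz. Qed.

Lemma perp_sym x y : perp x y -> perp y x.
Proof. by move=> /ortho_anti; rewrite orthoK. Qed.

(** A common lower bound of [x] and [y] lies below both [y'] and [y], whose
    meet is [0]. *)
Lemma ubound_L2_perp x y : perp x y -> ubound (L2 x y) = setT.
Proof.
move=> xy; apply/seteqP; split=> // z _ t /in_L2[tx ty].
have [_ bot_greatest] := ortho_meet y.
apply: le_trans (le0x z); apply: bot_greatest => s [->|->] //.
exact: le_trans tx xy.
Qed.

(** * The operators as intersections of blocks *)

Lemma SopE x y : Sop x y =
  ubound (L2 x y) `&` ubound (L2 x (ortho y)) `&` ubound (L2 (ortho x) y).
Proof. by rewrite /Sop !ubound_setU. Qed.

Lemma cop_Sop x y : cop x y = Sop x y `&` ubound (L2 (ortho x) (ortho y)).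
Proof. by rewrite /cop ubound_setU. Qed.

Lemma copE x y : cop x y =
  ubound (L2 x y) `&` ubound (L2 x (ortho y)) `&` ubound (L2 (ortho x) y)
    `&` ubound (L2 (ortho x) (ortho y)).
Proof. by rewrite cop_Sop SopE. Qed.

Lemma CrelE x y : Crel x y <->
  ubound [set x] = ubound (L2 x y) `&` ubound (L2 x (ortho y)).
Proof. by rewrite /Crel ubound_setU. Qed.

(** ** Symmetries *)

Lemma SopC x y : Sop x y = Sop y x.
Proof. by rewrite !SopE (L2C y x) (L2C y) (L2C (ortho y)) setIAC. Qed.

Lemma copC x y : cop x y = cop y x.
Proof. by rewrite !cop_Sop SopC L2C. Qed.

(** Negating an argument permutes the four blocks. *)
Lemma cop_orthor x y : cop x (ortho y) = cop x y.
Proof.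
rewrite !copE orthoK -!setIA setICA !setIA -setIA.
by rewrite [X in _ `&` X]setIC setIA.
Qed.

Lemma cop_orthol x y : cop (ortho x) y = cop x y.
Proof. by rewrite copC cop_orthor copC. Qed.

Lemma Crel_orthor x y : Crel x (ortho y) <-> Crel x y.
Proof. by rewrite !CrelE orthoK setIC. Qed.

(** ** Special values *)

Lemma ortho_bot : ortho (\bot : P) = \top.
Proof.
apply: le_anti; rewrite lex1 /= -[X in X <= _]orthoK.
exact/ortho_anti/le0x.
Qed.

Lemma ortho_top : ortho (\top : P) = \bot.
Proof. by rewrite -ortho_bot orthoK. Qed.

Lemma Sop_perp x y : perp x y -> Sop x y = U2 x y.
Proof.
move=> xy; rewrite SopE U2E ubound_L2_perp // setTI ubound_L2_le //.
by rewrite (L2C (ortho x)) ubound_L2_le //; exact: perp_sym.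
Qed.

Lemma Sop_botr x : Sop x \bot = ubound [set x].
Proof.
by rewrite Sop_perp ?U2E ?ubound_bot ?setIT // /perp ortho_bot lex1.
Qed.

Lemma Sop_diag x : Sop x x = ubound [set x].
Proof.
rewrite SopE (L2C (ortho x)) ubound_L2_le // ubound_L2_perp ?setIT //.
by rewrite /perp orthoK.
Qed.

Lemma Sop_ortho x : Sop x (ortho x) = [set \top].
Proof. by rewrite Sop_perp ?U2E ?ubound1_ortho // /perp orthoK. Qed.

Lemma Sop_topr x : Sop x \top = [set \top].
Proof.
rewrite SopE ubound_L2_le ?lex1 // ubound_L2_perp.
  by rewrite setIT ubound_L2_le ?lex1 // ubound1_ortho.
by rewrite /perp orthoK lex1.
Qed.

Lemma U2_sub_Sop x y : U2 x y `<=` Sop x y.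
Proof.
rewrite U2E SopE => z [zx zy]; split; first by split; exact: ubound_L2_sub.
by rewrite L2C; exact: ubound_L2_sub.
Qed.

(** ** Commuting elements *)

Lemma le_Crel x y : x <= y -> Crel x y.
Proof.
move=> xy; apply/CrelE; rewrite ubound_L2_le // ubound_L2_perp ?setIT //.
by rewrite /perp orthoK.
Qed.

Lemma cop_le x y : x <= y -> cop x y = Sop x y `&` ubound [set ortho y].
Proof.
by move=> /ortho_anti xy; rewrite cop_Sop L2C (ubound_L2_le _ _ xy).
Qed.

(** The block [U(L(x, y))] belongs to both decompositions, that of [U(x)] and
    that of [U(y)], which is why [S] needs only three blocks. *)
Lemma Crel_Sop x y : Crel x y -> Crel y x -> Sop x y = U2 x y.
Proof.
move=> /CrelE Cxy /CrelE Cyx; rewrite U2E Cxy Cyx SopE (L2C y x) (L2C y).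
by rewrite setIACA setIid setIA.
Qed.

(** The four blocks of [c(x, y)] pair up to [U(x) `&` U(x')]. *)
Lemma Crel_cop x y :
  Crel x y -> Crel (ortho x) (ortho y) -> cop x y = [set \top].
Proof.
move=> /CrelE Cxy /Crel_orthor /CrelE Cx'y.
by rewrite copE -setIA -Cxy -Cx'y ubound1_ortho.
Qed.

(** * Duality *)

(** The orthocomplementation is its own inverse, so images under it are also
    preimages. *)
Lemma osetE A : oset A = ortho @^-1` A.
Proof.
apply/seteqP; split=> [_ [x Ax <-]|x Ax]; first by rewrite /= orthoK.
by exists (ortho x) => //; exact: orthoK.
Qed.

Lemma osetK A : oset (oset A) = A.
Proof. by rewrite !osetE; apply/seteqP; split=> x; rewrite /= orthoK. Qed.

Lemma osetI A B : oset (A `&` B) = oset A `&` oset B.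
Proof. by rewrite !osetE preimage_setI. Qed.

Lemma oset1 x : oset [set x] = [set ortho x].
Proof. exact: image_set1. Qed.

Lemma oset2 x y : oset [set x; y] = [set ortho x; ortho y].
Proof. by rewrite /oset image_setU !image_set1. Qed.

Lemma oset_ubound A : oset (ubound A) = lbound (oset A).
Proof.
rewrite osetE; apply/seteqP; split=> z /= hz.
  by move=> _ [y Ay <-]; rewrite -[z]orthoK; apply/ortho_anti/hz.
move=> y Ay; rewrite -[y]orthoK; apply: ortho_anti.
by apply: hz; exists y.
Qed.

Lemma oset_lbound A : oset (lbound A) = ubound (oset A).
Proof. by rewrite -[in LHS](osetK A) -oset_ubound osetK. Qed.

Lemma oset_U2 x y : oset (U2 x y) = L2 (ortho x) (ortho y).
Proof. by rewrite /U2 oset_ubound oset2. Qed.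

Lemma oset_L2 x y : oset (L2 x y) = U2 (ortho x) (ortho y).
Proof. by rewrite /L2 oset_lbound oset2. Qed.

Lemma oset_Sop x y : oset (Sop x y) = Fop (ortho x) (ortho y).
Proof. by rewrite /Sop oset_ubound /oset !image_setU -!/(oset _) !oset_L2. Qed.

(** The form in which assertions about [S] are transported to [F]. *)
Lemma FopE x y : Fop x y = oset (Sop (ortho x) (ortho y)).
Proof. by rewrite oset_Sop !orthoK. Qed.

Lemma oset_cop x y :
  oset (cop x y) = Fop x y `&` lbound (U2 (ortho x) (ortho y)).
Proof.
rewrite FopE -(cop_orthol x y) -(cop_orthor (ortho x) y) cop_Sop osetI.
by rewrite oset_ubound oset_L2 !orthoK.
Qed.

Lemma oset_cop_le x y :
  x <= y -> oset (cop x y) = Fop x y `&` lbound [set ortho x].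
Proof.
move=> /ortho_anti yx; rewrite FopE SopC.
rewrite -(cop_orthol x y) -(cop_orthor (ortho x) y) copC (cop_le _ _ yx).
by rewrite osetI oset_ubound oset1 orthoK.
Qed.

End Orthoposet.

Theorem proposition4p2 (d : Order.disp_t) (P : orthoposetType d) (a b : P) :
  (* (i) *)
  ((cop a b = cop a (ortho b)) /\
   (cop a (ortho b) = cop (ortho a) b) /\
   (cop (ortho a) b = cop (ortho a) (ortho b)) /\
   (cop (ortho a) (ortho b) = cop b a) /\
   (cop b a = cop b (ortho a)) /\
   (cop b (ortho a) = cop (ortho b) a) /\
   (cop (ortho b) a = cop (ortho b) (ortho a))) /\
  (* (ii) *)
  (Crel a b <-> Crel a (ortho b)) /\
  (* (iii) *)
  (Sop a b = Sop b a /\ Fop a b = Fop b a) /\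
  (* (iv) *)
  (Fop a b = oset (Sop (ortho a) (ortho b)) /\
   Sop a b = oset (Fop (ortho a) (ortho b))) /\
  (* (v) *)
  ((Sop \bot a = Sop a \bot /\ Sop a \bot = Sop a a /\
    Sop a a = ubound [set a]) /\
   (Sop a (ortho a) = Sop a \top /\ Sop a \top = Sop \top a /\
    Sop \top a = [set \top])) /\
  (* (vi) *)
  ((Fop \bot a = Fop a \bot /\ Fop a \bot = Fop a (ortho a) /\
    Fop a (ortho a) = [set \bot]) /\
   (Fop a a = Fop a \top /\ Fop a \top = Fop \top a /\
    Fop \top a = lbound [set a])) /\
  (* (vii) *)
  (U2 a b `<=` Sop a b /\ L2 a b `<=` Fop a b) /\
  (* (viii) *)
  (cop a b = Sop a b `&` ubound (L2 (ortho a) (ortho b)) /\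
   oset (cop a b) = Fop a b `&` lbound (U2 (ortho a) (ortho b))) /\
  (* (ix) *)
  (a <= b ->
   Crel a b /\ Crel (ortho b) (ortho a) /\
   cop a b = Sop a b `&` ubound [set ortho b] /\
   oset (cop a b) = Fop a b `&` lbound [set ortho a]) /\
  (* (x) *)
  ((perp a b -> Sop a b = U2 a b) /\
   (perp (ortho a) (ortho b) -> Fop a b = L2 a b)) /\
  (* (xi) *)
  (Crel a b /\ Crel b a -> Sop a b = U2 a b) /\
  (* (xii) *)
  (Crel (ortho a) (ortho b) /\ Crel (ortho b) (ortho a) ->
   Fop a b = L2 a b) /\
  (* (xiii) *)
  (Crel a b /\ Crel (ortho a) (ortho b) -> cop a b = [set \top]).
Proof.
split; first by rewrite !(cop_orthol, cop_orthor) (copC b a).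
split; first by rewrite Crel_orthor.
split; first by rewrite !FopE (SopC a) (SopC (ortho a)).
split; first by split; [exact: FopE | rewrite -oset_Sop osetK].
split.
  by rewrite !(SopC \bot, SopC \top) Sop_botr Sop_diag Sop_ortho Sop_topr.
split.
  rewrite !FopE ortho_bot ortho_top !(SopC \bot, SopC \top).
  by rewrite Sop_botr Sop_diag Sop_ortho Sop_topr !oset_ubound
             !oset1 ortho_top orthoK.
split.
  split; first exact: U2_sub_Sop.
  rewrite FopE -[L2 a b]osetK oset_L2; apply: image_subset.
  exact: U2_sub_Sop.
split; first by split; [exact: cop_Sop | exact: oset_cop].
split.
  move=> ab; split; first exact: le_Crel.
  by split; [exact/le_Crel/ortho_anti | split;
             [exact: cop_le | exact: oset_cop_le]].
split.
  split; first exact: Sop_perp.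
  by move=> /Sop_perp; rewrite FopE => ->; rewrite oset_U2 !orthoK.
split; first by move=> [Cab Cba]; exact: Crel_Sop.
split; last by move=> [Cab Cab']; exact: Crel_cop.
by move=> [Cab Cba]; rewrite FopE Crel_Sop // oset_U2 !orthoK.
Qed.
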